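(* Let $G$ be a connected graph of order $n$. (i) If $G\ne K_{1,n-1}$ and $G$ has a dominating vertex (a vertex adjacent to all other vertices), then $s^+(G)\ge n$. (ii) If $G$ has domination number at most $2$, then $s^+(G)\ge n-1$.
   Context: All graphs are finite and simple. For a graph $G$ with adjacency matrix $A(G)$ and eigenvalues $\lambda_1(G)\ge\cdots\ge\lambda_n(G)$, define $s^+(G)=\sum_{\lambda_i(G)>0}\lambda_i(G)^2$. The domination number $\gamma(G)$ is the minimum size of a set $D\subseteq V(G)$ such that every vertex not in $D$ has a neighbour in $D$. $K_{1,n-1}$ denotes the star on $n$ vertices. *)

(* Defs.v *)
From HB Require Import structures.
From mathcomp Require Import all_boot all_order all_algebra.
From mathcomp Require Import polyrcf.

Set Implicit Arguments.
Unset Strict Implicit.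
Unset Printing Implicit Defensive.

Import Order.TTheory GRing.Theory Num.Theory.
Local Open Scope ring_scope.

(* A finite simple graph is a symmetric irreflexive relation on a finType. *)
Record simple_graph (T : finType) := SimpleGraph {
  adj :> rel T;
  adj_sym : symmetric adj;
  adj_irr : irreflexive adj
}.

Definition connected_graph (T : finType) (G : simple_graph T) : Prop :=
  forall x y : T, connect G x y.

Definition graph_iso (T U : finType) (G : simple_graph T)
    (H : simple_graph U) : Prop :=
  exists2 f : T -> U, bijective f & forall x y, H (f x) (f y) = G x y.

Definition complete_bipartite_rel (m n : nat) : rel ('I_m + 'I_n)%type :=
  fun u v => match u, v with
             | inl _, inr _ | inr _, inl _ => true
             | _, _ => false
             end.

Fact complete_bipartite_sym m n : symmetric (@complete_bipartite_rel m n).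
Proof. by case=> [i|i] [j|j]. Qed.

Fact complete_bipartite_irr m n : irreflexive (@complete_bipartite_rel m n).
Proof. by case. Qed.

Definition complete_bipartite m n : simple_graph ('I_m + 'I_n)%type :=
  SimpleGraph (@complete_bipartite_sym m n) (@complete_bipartite_irr m n).

Definition dominating_vertex (T : finType) (G : simple_graph T) (v : T) : Prop :=
  forall u : T, u != v -> G v u.

Definition dominating_set (T : finType) (G : simple_graph T)
    (D : {set T}) : bool :=
  [forall v, (v \notin D) ==> [exists u in D, G v u]].

Fact dominating_setT (T : finType) (G : simple_graph T) :
  dominating_set G [set: T].
Proof. by apply/forallP => v; rewrite in_setT. Qed.

(* The minimum is attained since [set: T] is dominating (dominating_setT). *)
Definition domination_number (T : finType) (G : simple_graph T) : nat :=
  #|[arg min_(D < [set: T] | dominating_set G D) #|D| ]|.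

Definition adjacency_mx (R : pzSemiRingType) (T : finType)
    (G : simple_graph T) : 'M[R]_#|T| :=
  \matrix_(i, j) (G (enum_val i) (enum_val j))%:R.

(* The eigenvalues of A in R in nonincreasing order, each repeated according *)
(* to its multiplicity as a root of the characteristic polynomial. When A is *)
(* symmetric that polynomial splits over R, so the list has length n.        *)
Definition eigenvalues (R : rcfType) (n : nat) (A : 'M[R]_n) : seq R :=
  flatten [seq nseq (mup x (char_poly A)) x | x <- rev (rootsR (char_poly A))].

Definition s_plus (R : rcfType) (T : finType) (G : simple_graph T) : R :=
  \sum_(x <- eigenvalues (adjacency_mx R G) | 0 < x) x ^+ 2.

(* Main.v *)
(* Among positive semidefinite X, 2 <A, X> - |X|^2 is at most s^+ (with equality
   at the positive part of A), so every explicit X gives a lower bound for s^+.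
   For a star with centre u and leaf set L, the positive part of its adjacency
   matrix is w w^T / (2 sqrt |L|) with w = sqrt |L| e_u + 1_L; it has nonnegative
   entries, so further edges of G never hurt.  It yields |L|, and adding
   (e_x + e_y)(e_x + e_y)^T / 2 for an edge xy between two leaves gains exactly 1,
   which settles (i).

   For (ii), let {u, v} dominate G with neither u nor v dominating, let L and M
   be the neighbourhoods of u and v (minus v and u) and k = |L :&: M|, so that
   |L| + |M| - k = n - 2.  The two stars lose at most k / 2 by overlapping on
   L :&: M, which suffices when k >= 2.  An edge inside L (or M) gains 1 on top
   of the stars at u and v with leaf sets L and M :\: L.  If k = 1, an edge
   between L :\: M and M :\: L, or the edge uv (through a rank two coupling of
   the two star vectors), makes up for the overlap.  In all other cases G is
   bipartite; then its spectrum is symmetric and s^+ is the number of edges,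
   which is at least n - 1. *)
Require Import Defs.
From mathcomp Require Import all_boot all_order all_algebra.
From mathcomp Require Import polyrcf complex ring lra.
Import Order.TTheory GRing.Theory Num.Theory.
Local Open Scope ring_scope.
Local Open Scope sesquilinear_scope.
Set Implicit Arguments.
Unset Strict Implicit.
Unset Printing Implicit Defensive.

(** * Spectra of real symmetric matrices and the test matrix inequality *)

Lemma char_poly_conj (F : comUnitRingType) n (P A : 'M[F]_n) :
  P \in unitmx -> char_poly (invmx P *m A *m P) = char_poly A.
Proof.
move=> uP; rewrite /char_poly.
have -> : char_poly_mx (invmx P *m A *m P) =
    map_mx polyC (invmx P) *m char_poly_mx A *m map_mx polyC P.
  rewrite /char_poly_mx mulmxBr mulmxBl -!map_mxM mul_mx_scalar -scalemxAl.
  by rewrite -map_mxM mulVmx // map_mx1 scalemx1.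
rewrite !det_mulmx mulrAC -det_mulmx -map_mxM mulVmx // map_mx1 det1.
by rewrite mul1r.
Qed.

(** Similarity invariance gives the factorization over [R[i]]; it descends to [R] because the
    embedding is injective on polynomials. *)
Lemma char_poly_unitary_diag (R : rcfType) n (A : 'M[R]_n) (P : 'M[R[i]]_n)
    (d : 'I_n -> R) :
    P \is unitarymx ->
    map_mx (real_complex R) A =
      P^t* *m diag_mx (\row_i (real_complex R (d i))) *m P ->
  char_poly A = \prod_i ('X - (d i)%:P).
Proof.
move=> uP eA; apply: (map_poly_inj (real_complex R)).
rewrite map_char_poly eA -invmx_unitary // char_poly_conj ?unitarymx_unit //.
rewrite char_poly_trig ?diag_mx_is_trig // rmorph_prod.
by apply: eq_bigr => i _; rewrite [RHS]map_polyXsubC !mxE eqxx mulr1n.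
Qed.

(** Over [R[i]] such an [A] is Hermitian, so the spectral theorem applies and the eigenvalues are
    real; only [P] stays complex. *)
Lemma symmetric_diagonalization (R : rcfType) n (A : 'M[R]_n) : A^T = A ->
  exists (P : 'M[R[i]]_n) (d : 'I_n -> R), P \is unitarymx /\
    map_mx (real_complex R) A =
      P^t* *m diag_mx (\row_i (real_complex R (d i))) *m P.
Proof.
move=> symA; pose B := map_mx (real_complex R) A.
have hB : B \is hermsymmx.
  apply: realsym_hermsym.
    apply/is_hermitianmxP; rewrite expr0 scale1r map_mx_id //.
    by rewrite /B map_trmx symA.
  by apply/mxOverP => i j; rewrite mxE complex_real.
have /orthomx_spectralP eB := hermitian_normalmx hB.
have uP := spectral_unitarymx B.
have /mxOverP rd := hermitian_spectral_diag_real hB.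
exists (spectralmx B), (fun i => complex.Re (spectral_diag B 0 i)); split=> //.
rewrite (_ : \row_i _ = spectral_diag B) -?invmx_unitary //.
by apply/rowP => i; rewrite mxE RRe_real.
Qed.

(** Either list contains each value as often as its multiplicity as a root of the characteristic
    polynomial. *)
Lemma perm_eigenvalues (R : rcfType) n (A : 'M[R]_n) (s : seq R) :
  char_poly A = \prod_(x <- s) ('X - x%:P) -> perm_eq (eigenvalues A) s.
Proof.
move=> eA; apply/allP => x _; apply/eqP => /=.
rewrite -[RHS]mu_prod_XsubC -eA /eigenvalues.
have p0 : char_poly A != 0 by rewrite monic_neq0 ?char_poly_monic.
rewrite count_flatten -map_comp sumnE big_map.
rewrite (perm_big (rootsR (char_poly A))) ?perm_rev //=.
rewrite (eq_bigr (fun y => (y == x) * mup x (char_poly A))%N); last first.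
  by move=> y _ /=; rewrite count_nseq /=; case: eqP => [->|].
have ur : uniq (rootsR (char_poly A)) by exact: uniq_roots.
rewrite -big_distrl /= -(big_mkcond (pred1 x) (fun=> 1%N)) sum1_count.
rewrite count_uniq_mem // -roots_on_rootsR //=.
case: (boolP (root _ _)) => [|/mupNroot ->]; first by rewrite mul1n.
by rewrite muln0.
Qed.

(* In an eigenbasis of A, X has diagonal entries z_i >= 0 and the claim reduces to
   2 d_i z_i - z_i^2 <= max(d_i, 0)^2 for each eigenvalue d_i. *)
Lemma psd_test_bound (R : rcfType) n (A X : 'M[R]_n) : A^T = A -> X^T = X ->
    (forall v : 'rV[R[i]]_n,
       0 <= (v *m map_mx (real_complex R) X *m v^t*) 0 0) ->
  2 * \tr (A *m X) - \tr (X *m X) <=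
    \sum_(x <- eigenvalues A | 0 < x) x ^+ 2.
Proof.
move=> symA symX psdX.
have [P [d [uP eA]]] := symmetric_diagonalization symA.
have cA := char_poly_unitary_diag uP eA.
have uP' : P^t* *m P = 1%:M by apply: mulmx1C; apply/unitarymxP.
rewrite (perm_big [seq d i | i <- enum 'I_n]) /=; last first.
  by apply: perm_eigenvalues; rewrite cA big_map big_enum.
rewrite big_map big_enum_cond /= big_mkcond /=.
set XC := map_mx (real_complex R) X in psdX *.
(* [Z] is [X] in the eigenbasis: tr(AX) becomes the sum of [d i * Z i i], and tr(XX) the sum of all
   |Z_ij|^2. *)
pose Z := P *m XC *m P^t*.
have trAX : real_complex R (\tr (A *m X)) = \sum_i real_complex R (d i) * Z i i.
  rewrite -trace_map_mx map_mxM eA -/XC -!mulmxA mxtrace_mulC -!mulmxA.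
  rewrite [P *m (XC *m _)]mulmxA -/Z.
  by apply: eq_bigr => i _; rewrite mul_diag_mx !mxE.
have trXX : real_complex R (\tr (X *m X)) = \sum_i \sum_j Z i j * (Z i j)^*.
  have <- : \tr (Z *m Z) = real_complex R (\tr (X *m X)).
    rewrite -trace_map_mx map_mxM -/XC /Z mxtrace_mulC !mulmxA.
    rewrite -(mulmxA _ (P^t*) P) uP' mulmx1 mxtrace_mulC !mulmxA.
    by rewrite uP' mul1mx.
  apply: eq_bigr => i _; rewrite mxE; apply: eq_bigr => j _.
  have {2}<- : Z^t* = Z; last by rewrite !mxE.
  rewrite /Z !trmx_mul !map_mxM !map_trmx !trmxK -map_mx_comp mulmxA.
  congr (_ *m _ *m _); first by apply: map_mx_id => x; exact: conjCK.
  by apply/matrixP => a b; rewrite !mxE -[in RHS]symX mxE; exact: conjc_real.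
have Zge0 i : 0 <= Z i i.
  rewrite (_ : Z i i = (row i P *m XC *m (row i P)^t*) 0 0) ?psdX //.
  rewrite /Z -!row_mul !mxE; apply: eq_bigr => k _.
  by rewrite !mxE; congr (_ * _); rewrite !mxE.
rewrite -lecR rmorphB rmorphM rmorph_nat /= trAX trXX rmorph_sum mulr_sumr -sumrB.
apply: ler_sum => i _.
(* Dropping the off-diagonal |Z_ij|^2 can only increase the left-hand side. *)
apply: (@le_trans _ _ (2 * (real_complex R (d i) * Z i i) - Z i i * (Z i i)^*)).
  rewrite lerD2l.
  rewrite  lerN2 (bigD1 i) //= lerDl; apply: sumr_ge0 => j _.
  exact: mul_conjC_ge0.
have := Zge0 i; have /complex_realP[z ->] : Z i i \is Num.real by exact: ger0_real.
rewrite ler0c => z0.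
rewrite (conj_Creal (x := real_complex R z)) ?complex_real //.
rewrite -!rmorphM -(rmorph_nat (real_complex R) 2) -rmorphM -rmorphB lecR.
(* For positive [d i] this is (d_i - z)^2 >= 0; otherwise both terms on the left are at most 0. *)
case: ltP => hd.
  by have := sqr_ge0 (d i - z); lra.
by have := mulr_le0_ge0 hd z0; have := sqr_ge0 z; lra.
Qed.

(** * Sums of rank-one test matrices, and the bipartite case *)

Lemma adjacency_mx_sym (R : pzSemiRingType) (T : finType) (G : simple_graph T) :
  (adjacency_mx R G)^T = adjacency_mx R G.
Proof. by apply/matrixP => i j; rewrite !mxE adj_sym. Qed.

Lemma sum_enum_val (R : nmodType) (T : finType) (F : T -> R) :
  \sum_(i < #|T|) F (enum_val i) = \sum_t F t.
Proof. by rewrite [RHS](reindex _ (onW_bij _ (@enum_val_bij T))). Qed.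

(** The test matrix is X = sum_i c_i w_i w_i^T, positive semidefinite since c_i >= 0. Only quadratic
    forms and inner products of the [w i] remain to be computed. *)
Lemma s_plus_ge_test (R : rcfType) (T I : finType) (G : simple_graph T)
    (c : I -> R) (w : I -> T -> R) : (forall i, 0 <= c i) ->
  \sum_i 2 * c i * (\sum_s \sum_t (G s t)%:R * (w i s * w i t)) -
  \sum_i \sum_j c i * c j * (\sum_t w i t * w j t) ^+ 2 <= s_plus R G.
Proof.
move=> c0.
pose X := \matrix_(k < #|T|, l < #|T|)
            \sum_i c i * (w i (enum_val k) * w i (enum_val l)).
have symX : X^T = X.
  apply/matrixP => k l; rewrite !mxE; apply: eq_bigr => i _.
  by rewrite [w i _ * _]mulrC.
have := @psd_test_bound R _ (adjacency_mx R G) X (adjacency_mx_sym R G) symX.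
have -> : \tr (adjacency_mx R G *m X) =
    \sum_i c i * (\sum_s \sum_t (G s t)%:R * (w i s * w i t)).
  transitivity (\sum_s \sum_t (G s t)%:R * \sum_i c i * (w i s * w i t)).
    rewrite -[RHS]sum_enum_val; apply: eq_bigr => k _; rewrite mxE.
    rewrite -[RHS]sum_enum_val; apply: eq_bigr => l _; rewrite !mxE.
    by congr (_ * _); apply: eq_bigr => i _; rewrite [w i _ * _]mulrC.
  under [RHS]eq_bigr => i _ do rewrite mulr_sumr.
  rewrite [RHS]exchange_big /=; apply: eq_bigr => s _.
  under [RHS]eq_bigr => i _ do rewrite mulr_sumr.
  rewrite [RHS]exchange_big /=; apply: eq_bigr => t _.
  by rewrite mulr_sumr; apply: eq_bigr => i _; rewrite mulrCA.
have -> : \tr (X *m X) = \sum_i \sum_j c i * c j * (\sum_t w i t * w j t) ^+ 2.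
  transitivity (\sum_s \sum_t (\sum_i c i * (w i s * w i t)) *
                              (\sum_j c j * (w j t * w j s))).
    rewrite -[RHS]sum_enum_val; apply: eq_bigr => k _; rewrite mxE.
    rewrite -[RHS]sum_enum_val; apply: eq_bigr => l _; rewrite !mxE //.
  under eq_bigr => s _ do under eq_bigr => t _ do rewrite big_distrlr /=.
  under eq_bigr => s _ do rewrite exchange_big /=.
  rewrite exchange_big /=; apply: eq_bigr => i _.
  under eq_bigr => s _ do rewrite exchange_big /=.
  rewrite exchange_big /=; apply: eq_bigr => j _.
  rewrite expr2 big_distrlr /= mulr_sumr; apply: eq_bigr => s _.
  rewrite mulr_sumr; apply: eq_bigr => t _.
  ring.
under [in X in _ -> X]eq_bigr => i _ do rewrite -mulrA.
rewrite -mulr_sumr; apply => v.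
(* [y i] pairs [v] with [w i], so the form of X at [v] is the sum of c_i |y_i|^2. *)
pose y i := \sum_k v 0 k * real_complex R (w i (enum_val k)).
have -> : (v *m map_mx (real_complex R) X *m v^t*) 0 0 =
    \sum_i real_complex R (c i) * (y i * (y i)^*).
  rewrite !mxE.
  under eq_bigr => l _ do rewrite !mxE big_distrl /=.
  transitivity (\sum_l \sum_k \sum_i real_complex R (c i) *
    ((v 0 k * real_complex R (w i (enum_val k))) * 
     ((v 0 l)^* * real_complex R (w i (enum_val l))))).
    apply: eq_bigr => l _; apply: eq_bigr => k _.
    rewrite !mxE rmorph_sum /= mulr_sumr mulr_suml; apply: eq_bigr => i _.
    rewrite !rmorphM /=. ring.
  under eq_bigr => s _ do rewrite exchange_big /=.
  rewrite exchange_big /=; apply: eq_bigr => i _.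
  rewrite exchange_big /=.
  rewrite /y rmorph_sum /= big_distrlr /= mulr_sumr; apply: eq_bigr => k _.
  rewrite mulr_sumr; apply: eq_bigr => l _.
  by rewrite rmorphM /= (conj_Creal (x := real_complex R _)) ?complex_real.
apply: sumr_ge0 => i _; apply: mulr_ge0; first by rewrite ler0c.
exact: mul_conjC_ge0.
Qed.

Lemma s_plus_ge0 (R : rcfType) (T : finType) (G : simple_graph T) :
  0 <= s_plus R G.
Proof. by apply: sumr_ge0 => x _; apply: sqr_ge0. Qed.

(* Conjugation by the diagonal sign matrix of the colouring turns A into -A. *)
Lemma s_plus_bipartite (R : rcfType) (T : finType) (G : simple_graph T)
    (col : pred T) : (forall s t, G s t -> col s != col t) ->
  2 * s_plus R G = (\sum_s \sum_t G s t)%:R.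
Proof.
move=> hcol; pose A := adjacency_mx R G.
have [P [d [uP eA]]] := symmetric_diagonalization (adjacency_mx_sym R G).
have cA := char_poly_unitary_diag uP eA.
have eNA : map_mx (real_complex R) (- A) =
    P^t* *m diag_mx (\row_i (real_complex R (- d i))) *m P.
  rewrite map_mxN eA -mulNmx -mulmxN; congr (_ *m _ *m _).
  by apply/matrixP => i j; rewrite !mxE rmorphN mulNrn.
pose D := diag_mx (\row_(i < #|T|) (-1) ^+ col (enum_val i)) : 'M[R]_#|T|.
have DD : D *m D = 1%:M.
  apply/matrixP => i j; rewrite mul_diag_mx !mxE.
  by case: eqP => [->|_]; rewrite ?mulr0 // !mulr1n -expr2 sqrr_sign.
have [uD _] := mulmx1_unit DD.
have eD : invmx D = D by rewrite -[RHS](mulKmx uD) DD mulmx1.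
have eDAD : invmx D *m A *m D = - A.
  rewrite eD; apply/matrixP => i j; rewrite mul_mx_diag mul_diag_mx !mxE.
  case: (boolP (G _ _)) => [/hcol|_]; last by rewrite mulr0 mul0r oppr0.
  by case: (col _); case: (col _) => // _; rewrite /= !mulr1 ?mul1r.
have cNA : char_poly A = \prod_i ('X - (- d i)%:P).
  by rewrite -(char_poly_unitary_diag uP eNA) -eDAD char_poly_conj.
have e1 : s_plus R G = \sum_i (if 0 < d i then d i ^+ 2 else 0).
  rewrite /s_plus (perm_big [seq d i | i <- enum 'I_#|T|]) /=.
    by rewrite big_map big_enum_cond /= big_mkcond.
  by apply: perm_eigenvalues; rewrite cA big_map big_enum.
(* The values [- d i] list the same spectrum, so this sum collects the squares of the negative
   [d i]; added to [e1] it gives all squares. *)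
have e2 : s_plus R G = \sum_i (if 0 < - d i then (- d i) ^+ 2 else 0).
  rewrite /s_plus (perm_big [seq - d i | i <- enum 'I_#|T|]) /=.
    by rewrite big_map big_enum_cond /= big_mkcond.
  by apply: perm_eigenvalues; rewrite cNA big_map big_enum.
have e3 : \tr (A *m A) = \sum_i d i ^+ 2.
  apply: (@complexI R); rewrite -trace_map_mx map_mxM eA.
  rewrite !mulmxA -(mulmxA _ P (P^t*)) (unitarymxP uP) mulmx1.
  rewrite mxtrace_mulC !mulmxA (unitarymxP uP) mul1mx.
  rewrite rmorph_sum; apply: eq_bigr => i _; rewrite mul_diag_mx !mxE eqxx.
  by rewrite mulr1n rmorphXn /= expr2.
have -> : (\sum_s \sum_t G s t)%:R = \tr (A *m A) :> R.
  rewrite natr_sum -[LHS]sum_enum_val; apply: eq_bigr => i _; rewrite mxE.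
  rewrite natr_sum -[LHS]sum_enum_val; apply: eq_bigr => j _; rewrite !mxE.
  by rewrite [G (enum_val j) _]adj_sym -natrM mulnb andbb.
rewrite e3 mulr_natl mulr2n {1}e1 e2 -big_split /=; apply: eq_bigr => i _.
rewrite oppr_gt0 sqrrN; case: ltrgtP => [||<-]; rewrite ?addr0 ?add0r //.
by rewrite expr0n.
Qed.

(** * Test vectors of stars and single edges *)

Section TestVectors.
Variables (R : rcfType) (T : finType) (G : simple_graph T).
Implicit Types (f g : T -> R) (u v x y : T) (L M : {set T}) (a b : R).

Definition dot f g := \sum_t f t * g t.
Definition qform f g := \sum_s \sum_t (G s t)%:R * (f s * g t).
(** For nonempty [L] avoiding [u] and [a] the square root of |L|, an eigenvector of the star for the
    eigenvalue [a]. *)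
Definition star_vec u L a : T -> R := fun t => a * (t == u)%:R + (t \in L)%:R.
Definition edge_vec x y : T -> R := fun t => (t == x)%:R + (t == y)%:R.

Lemma sum_pred1_mul (F : T -> R) x : \sum_t (t == x)%:R * F t = F x.
Proof.
rewrite (bigD1 x) //= eqxx mul1r big1 ?addr0 // => t /negPf ->.
by rewrite mul0r.
Qed.

Lemma sum_mem_mul (F : T -> R) L : \sum_t (t \in L)%:R * F t = \sum_(t in L) F t.
Proof. by rewrite [RHS]big_mkcond; apply: eq_bigr => t _; rewrite mulr_natl mulrb. Qed.

Lemma qform_addl f g h : qform (fun t => f t + g t) h = qform f h + qform g h.
Proof.
rewrite /qform -big_split; apply: eq_bigr => s _; rewrite -big_split /=.
by apply: eq_bigr => t _; ring.
Qed.

Lemma qformC f g : qform f g = qform g f.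
Proof.
rewrite /qform exchange_big; apply: eq_bigr => s _; apply: eq_bigr => t _.
by rewrite adj_sym [f _ * _]mulrC.
Qed.

Lemma dot_addl f g h : dot (fun t => f t + g t) h = dot f h + dot g h.
Proof. by rewrite /dot -big_split; apply: eq_bigr => t _; rewrite /= mulrDl. Qed.

Lemma dotC f g : dot f g = dot g f.
Proof. by apply: eq_bigr => t _; rewrite mulrC. Qed.

Lemma s_plus_ge_test3 (c1 c2 c3 : R) f1 f2 f3 :
    0 <= c1 -> 0 <= c2 -> 0 <= c3 ->
  2 * (c1 * qform f1 f1 + c2 * qform f2 f2 + c3 * qform f3 f3)
  - (c1 ^+ 2 * dot f1 f1 ^+ 2 + c2 ^+ 2 * dot f2 f2 ^+ 2
     + c3 ^+ 2 * dot f3 f3 ^+ 2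
     + 2 * (c1 * c2 * dot f1 f2 ^+ 2 + c1 * c3 * dot f1 f3 ^+ 2
            + c2 * c3 * dot f2 f3 ^+ 2)) <= s_plus R G.
Proof.
move=> h1 h2 h3.
pose c (i : 'I_3) := [:: c1; c2; c3]`_i.
pose w (i : 'I_3) := nth f1 [:: f1; f2; f3] i.
have c0 i : 0 <= c i by case: i => -[|[|[|]]].
apply: le_trans (s_plus_ge_test G w c0).
rewrite !big_ord_recl !big_ord0 /c /w /= -!/(dot _ _) -!/(qform _ _).
by rewrite (dotC f2 f1) (dotC f3 f1) (dotC f3 f2); lra.
Qed.

Lemma dot_star_vec u L a : u \notin L ->
  dot (star_vec u L a) (star_vec u L a) = a ^+ 2 + #|L|%:R.
Proof.
move=> /negPf uL; rewrite /dot /star_vec.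
under eq_bigr => t _ do rewrite mulrDl -mulrA.
rewrite big_split /= -mulr_sumr sum_pred1_mul sum_mem_mul uL eqxx addr0 mulr1.
rewrite -expr2; congr (_ + _); rewrite -sum1_card natr_sum.
apply: eq_bigr => t tL; rewrite tL; case: eqP => [tu|_]; last by rewrite mulr0 add0r.
by rewrite -tu tL in uL.
Qed.

(** Each centre lies outside the other star, so the supports meet only in [L :&: M], where both
    vectors equal 1. *)
Lemma dot_star_vec2 u v L M a b : u != v -> u \notin M -> v \notin L ->
  dot (star_vec u L a) (star_vec v M b) = #|L :&: M|%:R.
Proof.
move=> /negPf uv /negPf uM vL; rewrite /dot /star_vec.
under eq_bigr => t _ do rewrite mulrDl -mulrA.
rewrite big_split /= -mulr_sumr sum_pred1_mul sum_mem_mul uM uv.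
rewrite mulr0 addr0 mulr0 add0r -sum1_card natr_sum (big_setID M) /=.
rewrite [X in _ + X]big1 => [|t]; last first.
  rewrite inE => /andP[/negPf -> tL]; case: eqP tL vL => [->->//|].
  by rewrite mulr0 addr0.
rewrite addr0; apply: eq_bigr => t; rewrite inE => /andP[tL ->].
by case: eqP tL vL => [->->//|]; rewrite mulr0 add0r.
Qed.

Lemma dot_edge_vec f x y : dot f (edge_vec x y) = f x + f y.
Proof.
rewrite /dot /edge_vec; under eq_bigr => t _ do rewrite mulrC mulrDl.
by rewrite big_split /= !sum_pred1_mul.
Qed.

Lemma qform_edge_vec x y : G x y -> qform (edge_vec x y) (edge_vec x y) = 2.
Proof.
move=> Gxy; rewrite /qform.
under eq_bigr => s _ do under eq_bigr => t _ do rewrite mulrCA.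
under eq_bigr => s _ do rewrite -mulr_sumr -/(dot _ _) dot_edge_vec mulrC.
rewrite -/(dot _ _) dot_edge_vec !adj_irr Gxy adj_sym Gxy.
by rewrite add0r addr0.
Qed.

Lemma qform_star_vec2 u v L M a b :
  qform (star_vec u L a) (star_vec v M b) =
  a * b * (G u v)%:R + a * \sum_(t in M) (G u t)%:R +
  b * \sum_(s in L) (G s v)%:R + \sum_(s in L) \sum_(t in M) (G s t)%:R.
Proof.
have rowE s : \sum_t (G s t)%:R * star_vec v M b t =
    b * (G s v)%:R + \sum_(t in M) (G s t)%:R.
  rewrite /star_vec; under eq_bigr => t _ do rewrite mulrC mulrDl -mulrA.
  by rewrite big_split /= -mulr_sumr sum_pred1_mul sum_mem_mul.
rewrite /qform; under eq_bigr => s _ do under eq_bigr => t _ do rewrite mulrCA.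
under eq_bigr => s _.
  rewrite -mulr_sumr rowE [star_vec _ _ _ _]/star_vec mulrDl -mulrA.
over.
rewrite big_split /= -mulr_sumr sum_pred1_mul sum_mem_mul big_split /=.
by rewrite -mulr_sumr; ring.
Qed.

Lemma qform_star_vec u L a : u \notin L -> {in L, forall t, G u t} ->
  qform (star_vec u L a) (star_vec u L a) =
  2 * a * #|L|%:R + \sum_(s in L) \sum_(t in L) (G s t)%:R.
Proof.
move=> uL GuL; rewrite qform_star_vec2 adj_irr.
have cL : \sum_(t in L) (G u t)%:R = #|L|%:R :> R.
  by rewrite -sum1_card natr_sum; apply: eq_bigr => t /GuL ->.
under [X in _ + _ * X + _]eq_bigr => s _ do rewrite adj_sym.
by rewrite cL /=; ring.
Qed.

Lemma qform_star_vec_ge u L a : u \notin L -> {in L, forall t, G u t} ->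
  2 * a * #|L|%:R <= qform (star_vec u L a) (star_vec u L a).
Proof.
move=> uL GuL; rewrite qform_star_vec // lerDl.
by apply: sumr_ge0 => s _; apply: sumr_ge0 => t _; apply: ler0n.
Qed.

(** The edge between two leaves enters the double sum over [L] in both orders, hence the extra 2. *)
Lemma qform_star_vec_edge_ge u L a x y : u \notin L -> {in L, forall t, G u t} ->
    x \in L -> y \in L -> G x y ->
  2 * a * #|L|%:R + 2 <= qform (star_vec u L a) (star_vec u L a).
Proof.
move=> uL GuL xL yL Gxy; rewrite qform_star_vec // lerD2l.
have rowge s t : s \in L -> t \in L -> G s t -> 1 <= \sum_(t in L) (G s t)%:R :> R.
  move=> sL tL Gst; rewrite (bigD1 t) //= Gst lerDl.
  by apply: sumr_ge0 => z _; apply: ler0n.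
have nxy : y != x by apply: contraTneq Gxy => ->; rewrite adj_irr.
pose deg s : R := \sum_(t in L) (G s t)%:R.
have deg0 s : 0 <= deg s by apply: sumr_ge0 => t _; apply: ler0n.
have dx : 1 <= deg x by exact: rowge yL Gxy.
have dy : 1 <= deg y by apply: rowge xL _; rewrite 1?adj_sym.
rewrite (eq_bigr deg) // (bigD1 x) //= (bigD1 y) ?yL //=.
apply: (@le_trans _ _ (deg x + (deg y + 0))); first by lra.
by rewrite !lerD2l; apply: sumr_ge0.
Qed.

(* [star_coef 0 = 0], so empty stars need no separate treatment. *)
Definition star_coef a : R := (2 * a)^-1.

(** The factor [a ^+ 2] keeps the identity valid at [a = 0]. *)
Lemma star_coefE a : 2 * star_coef a * a ^+ 2 = a.
Proof.
rewrite /star_coef; have [->|a0] := eqVneq a 0; first by rewrite expr0n mulr0.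
by field.
Qed.

Lemma star_coef_ge0 a : 0 <= a -> 0 <= star_coef a.
Proof. by move=> a0; rewrite invr_ge0 mulr_ge0. Qed.

Lemma star_coefM2 a p : 2 * p * a ^+ 2 = a -> a != 0 -> 2 * p * a = 1.
Proof. by move=> pE a0; apply: (mulIf a0); rewrite mul1r -[RHS]pE; ring. Qed.

(** Here p = 1/(2a) <= 1/(2 sqrt 2) = 0.3535..., and 9/25 is a rational bound slightly above it. *)
Lemma star_coef_small a p : 0 <= a -> 0 <= p -> 2 <= a ^+ 2 ->
  2 * p * a = 1 -> p <= 9 / 25.
Proof.
move=> a0 p0 a2 pa; rewrite leNgt; apply/negP => p1.
have : (2 * p * a) ^+ 2 = 1 by rewrite pa expr1n.
rewrite (_ : _ ^+ 2 = 4 * p ^+ 2 * a ^+ 2); last by ring.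
have : (9 / 25) ^+ 2 <= p ^+ 2 by rewrite ler_pXn2r ?nnegrE //; lra.
nra.
Qed.

(** With a = sqrt |L| and p = 1/(2a), p w w^T is the positive part of the star. These relations hide
    the square root, leaving polynomial arithmetic to the later proofs. *)
Lemma star_vec_normalized u L : u \notin L -> {in L, forall t, G u t} ->
  exists a p : R, let w := star_vec u L a in
  [/\ 0 <= a, 0 <= p & 2 * p * a ^+ 2 = a] /\
  [/\ a ^+ 2 = #|L|%:R, p * dot w w = a,
      2 * a ^+ 3 <= qform w w, a ^+ 2 <= p * qform w w &
      forall x y, x \in L -> y \in L -> G x y ->
        a ^+ 2 + 2 * p <= p * qform w w].
Proof.
move=> uL GuL; pose a : R := Num.sqrt #|L|%:R; exists a, (star_coef a) => w.
have a0 : 0 <= a by exact: sqrtr_ge0.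
have aE : a ^+ 2 = #|L|%:R by rewrite sqr_sqrtr.
have p0 : 0 <= star_coef a by exact: star_coef_ge0.
have := star_coefE a; set p := star_coef a in p0 * => pE.
have paa : p * (2 * a * a ^+ 2) = a ^+ 2.
  by transitivity ((2 * p * a ^+ 2) * a); [ring | rewrite pE; ring].
split=> //; split=> //.
- by rewrite dot_star_vec // -aE -[RHS]pE; ring.
- by have := qform_star_vec_ge a uL GuL; rewrite -aE; rewrite -mulrA -exprS.
- by have := ler_wpM2l p0 (qform_star_vec_ge a uL GuL); rewrite -aE paa.
- move=> x y xL yL Gxy.
  have := ler_wpM2l p0 (qform_star_vec_edge_ge a uL GuL xL yL Gxy).
  by rewrite -aE mulrDr paa [p * 2]mulrC.
Qed.

Lemma star_bound u L : u \notin L -> {in L, forall t, G u t} ->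
  #|L|%:R <= s_plus R G.
Proof.
move=> uL GuL; have [a [p [[_ p0 _] [<- pn _ pq _]]]] := star_vec_normalized uL GuL.
apply: le_trans (s_plus_ge_test3 (star_vec u L a) (star_vec u L a)
  (star_vec u L a) p0 (lexx 0) (lexx 0)).
by rewrite -!exprMn pn; lra.
Qed.

(** The edge vector has inner product 2 with the star vector, which costs 4p; the edge inside [L]
    repays exactly that in the quadratic form of the star, and the net gain is 1. *)
Lemma star_edge_bound u L x y : u \notin L -> {in L, forall t, G u t} ->
    x \in L -> y \in L -> G x y ->
  #|L|%:R + 1 <= s_plus R G.
Proof.
move=> uL GuL xL yL Gxy.
have [a [p [[_ p0 _] [<- pn _ _ pq]]]] := star_vec_normalized uL GuL.
have {}pq := pq _ _ xL yL Gxy.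
have h0 : 0 <= 1 / 2 :> R by lra.
apply: le_trans (s_plus_ge_test3 (star_vec u L a) (edge_vec x y)
  (edge_vec x y) p0 h0 (lexx 0)).
have ux : x == u = false by apply: contraNF uL => /eqP <-.
have uy : y == u = false by apply: contraNF uL => /eqP <-.
have xy : x == y = false by apply: contraTF Gxy => /eqP ->; rewrite adj_irr.
rewrite -!exprMn pn qform_edge_vec // !dot_edge_vec /star_vec /edge_vec.
rewrite !eqxx ux uy xy [y == x]eq_sym xy xL yL /= !(mulr0, add0r, addr0).
lra.
Qed.

(** * Combining the stars at two centres *)

Section TwoStars.
Variables (u v : T) (L M : {set T}).
Hypotheses (uv : u != v) (uL : u \notin L) (vL : v \notin L)
  (uM : u \notin M) (vM : v \notin M)
  (GuL : {in L, forall t, G u t}) (GvM : {in M, forall t, G v t}).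

(** By disjointness the second star vector is orthogonal to the first and to the edge vector, so the
    gains simply add up. *)
Lemma two_stars_edge_bound x y : [disjoint L & M] ->
    x \in L -> y \in L -> G x y ->
  #|L|%:R + #|M|%:R + 1 <= s_plus R G.
Proof.
move=> dLM xL yL Gxy.
have [a [p [[_ p0 _] [<- pn _ _ pq]]]] := star_vec_normalized uL GuL.
have {}pq := pq _ _ xL yL Gxy.
have [b [r [[_ r0 _] [<- rn _ rq _]]]] := star_vec_normalized vM GvM.
have h0 : 0 <= 1 / 2 :> R by lra.
apply: le_trans (s_plus_ge_test3 (star_vec u L a) (star_vec v M b)
  (edge_vec x y) p0 r0 h0).
have xu : x == u = false by apply: contraNF uL => /eqP <-.
have yu : y == u = false by apply: contraNF uL => /eqP <-.
have xv : x == v = false by apply: contraNF vL => /eqP <-.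
have yv : y == v = false by apply: contraNF vL => /eqP <-.
have xy : x == y = false by apply: contraTF Gxy => /eqP ->; rewrite adj_irr.
have xM : x \in M = false by rewrite (disjointFr dLM).
have yM : y \in M = false by rewrite (disjointFr dLM).
have LM0 : #|L :&: M| = 0%N by apply/eqP; rewrite cards_eq0 setI_eq0.
rewrite -!exprMn pn rn qform_edge_vec // (dot_star_vec2 a b uv uM vL) LM0.
rewrite !dot_edge_vec /star_vec /edge_vec.
rewrite !eqxx xu yu xv yv xy [y == x]eq_sym xy xL yL xM yM /= !(mulr0, add0r, addr0).
lra.
Qed.

(** The overlap costs 2prk^2 with k = |L :&: M|. From k <= ab this is at most k/2, hence at most k -
    1 for k >= 2. *)
Lemma two_stars_common_bound : (1 < #|L :&: M|)%N ->
  #|L|%:R + #|M|%:R + 1 <= s_plus R G + #|L :&: M|%:R.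
Proof.
move=> k2.
have kL : (#|L :&: M| <= #|L|)%N by apply: subset_leq_card; apply: subsetIl.
have kM : (#|L :&: M| <= #|M|)%N by apply: subset_leq_card; apply: subsetIr.
have [a [p [[a0 p0 pE] [aE pn _ pq _]]]] := star_vec_normalized uL GuL.
have [b [r [[b0 r0 rE] [bE rn _ rq _]]]] := star_vec_normalized vM GvM.
have := s_plus_ge_test3 (star_vec u L a) (star_vec v M b)
  (star_vec u L a) p0 r0 (lexx 0).
rewrite -!exprMn pn rn (dot_star_vec2 a b uv uM vL).
move: kL kM k2; rewrite -(ler_nat R) -(ler_nat R #|_ :&: _|) -(ltr_nat R).
rewrite -aE -bE => kL kM k2.
have k2' : 2 <= #|L :&: M|%:R :> R by rewrite ler_nat -(ltr_nat R).
move: (#|L :&: M|%:R : R) kL kM k2' {k2} => k kL kM k2.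
have an0 : a != 0 by apply: contraTneq kL => ->; rewrite -ltNge expr0n /=; lra.
have bn0 : b != 0 by apply: contraTneq kM => ->; rewrite -ltNge expr0n /=; lra.
have pa := star_coefM2 pE an0; have rb := star_coefM2 rE bn0.
have kab : k <= a * b.
  rewrite -(ler_pXn2r (n := 2)) ?nnegrE ?mulr_ge0 //; last by lra.
  by rewrite exprMn expr2 ler_pM //; lra.
have prk : 2 * (p * r) * k <= 1 / 2.
  apply: (@le_trans _ _ (2 * (p * r) * (a * b))).
    by apply: ler_wpM2l => //; rewrite mulr_ge0 ?mulr_ge0.
  have -> : 2 * (p * r) * (a * b) = (2 * p * a) * (2 * r * b) / 2 by field.
  by rewrite pa rb; lra.
have k0 : 0 <= k by lra.
have := ler_wpM2r k0 prk. lra.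
Qed.

(** The edge gains 1, while the overlaps of the three vectors cost 2pr + p + r; this is below 1 once
    p and r are at most 9/25. *)
Lemma two_stars_cross_bound x y : #|L :&: M| = 1%N ->
    x \in L :\: M -> y \in M :\: L -> G x y ->
  #|L|%:R + #|M|%:R <= s_plus R G.
Proof.
move=> k1 /setDP[xL xM] /setDP[yM yL] Gxy.
(* The common neighbour and [x] are two leaves in [L]; likewise with [y] in [M]. *)
have cL : (2 <= #|L|)%N.
  have := cardsID M L; rewrite k1 => <-; rewrite ltnS card_gt0.
  by apply/set0Pn; exists x; rewrite inE xM.
have cM : (2 <= #|M|)%N.
  have := cardsID L M; rewrite setIC k1 => <-; rewrite ltnS card_gt0.
  by apply/set0Pn; exists y; rewrite inE yL.
have [a [p [[a0 p0 pE] [aE pn _ pq _]]]] := star_vec_normalized uL GuL.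
have [b [r [[b0 r0 rE] [bE rn _ rq _]]]] := star_vec_normalized vM GvM.
have h0 : 0 <= 1 / 2 :> R by lra.
have := s_plus_ge_test3 (star_vec u L a) (star_vec v M b)
  (edge_vec x y) p0 r0 h0.
have xu : x == u = false by apply: contraNF uL => /eqP <-.
have yu : y == u = false by apply: contraNF uM => /eqP <-.
have xv : x == v = false by apply: contraNF vL => /eqP <-.
have yv : y == v = false by apply: contraNF vM => /eqP <-.
have xy : x == y = false by apply: contraTF Gxy => /eqP ->; rewrite adj_irr.
rewrite -!exprMn pn rn qform_edge_vec // (dot_star_vec2 a b uv uM vL) k1.
rewrite !dot_edge_vec /star_vec /edge_vec.
rewrite !eqxx xu yu xv yv xy [y == x]eq_sym xy xL yM (negPf xM) (negPf yL).
rewrite /= !(mulr0, add0r, addr0).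
move: cL cM; rewrite -(ler_nat R) -(ler_nat R 2 #|M|) -aE -bE => cL cM.
have an0 : a != 0 by apply: contraTneq cL => ->; rewrite -ltNge expr0n /=; lra.
have bn0 : b != 0 by apply: contraTneq cM => ->; rewrite -ltNge expr0n /=; lra.
have pa := star_coefM2 pE an0; have rb := star_coefM2 rE bn0.
have ps := star_coef_small a0 p0 cL pa; have rs := star_coef_small b0 r0 cM rb.
have : p * r <= 9 / 25 * (9 / 25) by exact: ler_pM.
lra.
Qed.

(** The edges uv, uc and cv contribute ab, a and b respectively. *)
Lemma qform_star_vec2_ge c a b : 0 <= a -> 0 <= b -> G u v -> c \in L :&: M ->
  a * b + a + b <= qform (star_vec u L a) (star_vec v M b).
Proof.
move=> a0 b0 Guv /setIP[cL cM]; rewrite qform_star_vec2 Guv mulr1.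
have hc (F : T -> bool) (N : {set T}) : c \in N -> F c ->
    1 <= \sum_(t in N) (F t)%:R :> R.
  move=> cN Fc; rewrite (bigD1 c) //= Fc lerDl.
  by apply: sumr_ge0 => t _; apply: ler0n.
have h1 := ler_wpM2l a0 (hc (G u) M cM (GuL cL)).
have h2 := ler_wpM2l b0 (hc (G^~ v) L cL _).
rewrite adj_sym GvM // in h2; have {}h2 := h2 isT.
have : 0 <= \sum_(s in L) \sum_(t in M) (G s t)%:R :> R.
  by apply: sumr_ge0 => s _; apply: sumr_ge0 => t _; apply: ler0n.
lra.
Qed.

(* The test matrix is w w^T / (2a) + z z^T / (2b) + (w z^T + z w^T) / (4ab) for the
   star vectors w and z; it is a nonnegative combination of the squares of w, z
   and w + z. *)
Lemma two_stars_adjacent_bound : G u v -> #|L :&: M| = 1%N ->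
  (1 < #|L|)%N -> (1 < #|M|)%N -> #|L|%:R + #|M|%:R <= s_plus R G.
Proof.
move=> Guv k1 cL cM.
have [a [p [[a0 p0 pE] [aE pn q1 _ _]]]] := star_vec_normalized uL GuL.
have [b [r [[b0 r0 rE] [bE rn q2 _ _]]]] := star_vec_normalized vM GvM.
have [c cLM] : exists c, c \in L :&: M by apply/set0Pn; rewrite -card_gt0 k1.
have q12 := qform_star_vec2_ge a0 b0 Guv cLM.
move: cL cM; rewrite -(ler_nat R) -(ler_nat R 2 #|M|) -aE -bE => cL cM.
have an0 : a != 0 by apply: contraTneq cL => ->; rewrite -ltNge expr0n /=; lra.
have bn0 : b != 0 by apply: contraTneq cM => ->; rewrite -ltNge expr0n /=; lra.
have pa := star_coefM2 pE an0; have rb := star_coefM2 rE bn0.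
set w := star_vec u L a in pn q1 q12; set z := star_vec v M b in rn q2 q12.
have dwz : dot w z = 1 by rewrite /w /z dot_star_vec2 // k1.
have dww : dot w w = 2 * a ^+ 2 by rewrite dot_star_vec // -aE; ring.
have dzz : dot z z = 2 * b ^+ 2 by rewrite dot_star_vec // -bE; ring.
have p1 := star_coef_small a0 p0 cL pa; have r1 := star_coef_small b0 r0 cM rb.
have s0 : 0 <= p * r by exact: mulr_ge0.
(* The coupling 1/(4ab) equals pr. Writing it through the square of w + z leaves p - pr and r - pr
   on the squares of w and z. *)
have c1 : 0 <= p - p * r by have := ler_wpM2l p0 r1; lra.
have c2 : 0 <= r - p * r by have := ler_wpM2r r0 p1; lra.
pose y t := w t + z t.
have yw : dot w y = 2 * a ^+ 2 + 1.
  by rewrite dotC (dot_addl w z) dww dotC dwz.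
have yz : dot z y = 1 + 2 * b ^+ 2.
  by rewrite dotC (dot_addl w z) dzz dwz.
have yy : dot y y = 2 * a ^+ 2 + 2 * b ^+ 2 + 2.
  by rewrite (dot_addl w z) yw yz; ring.
have Qy : qform y y = qform w w + qform z z + 2 * qform w z.
  rewrite (qform_addl w z) (qformC w y) (qformC z y) !(qform_addl w z).
  by rewrite (qformC z w); ring.
have := s_plus_ge_test3 w z y c1 c2 s0.
rewrite Qy yw yz yy dwz dww dzz.
set Qw := qform w w in q1 *; set Qz := qform z z in q2 *.
set Qwz := qform w z in q12 *; set N := (_ + _ + _ + _ : R).
(* The squared norm is regrouped so that 2pa^2 and 2rb^2 can be replaced by a and b. *)
have -> : N = (2 * p * a ^+ 2 + p * r) ^+ 2 + (2 * r * b ^+ 2 + p * r) ^+ 2 +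
    2 * (p + p * (2 * r * b ^+ 2)) * (r + r * (2 * p * a ^+ 2)).
  by rewrite /N; ring.
rewrite pE rE.
have sab : p * r * (a * b) = 1 / 4.
  have -> : p * r * (a * b) = (2 * p * a) * (2 * r * b) / 4 by field.
  by rewrite pa rb; lra.
have pq : a ^+ 2 <= p * Qw.
  have := ler_wpM2l p0 q1; rewrite (_ : p * (2 * a ^+ 3) = (2 * p * a) * a ^+ 2).
    by rewrite pa mul1r.
  by ring.
have rq : b ^+ 2 <= r * Qz.
  have := ler_wpM2l r0 q2; rewrite (_ : r * (2 * b ^+ 3) = (2 * r * b) * b ^+ 2).
    by rewrite rb mul1r.
  by ring.
have sq := ler_wpM2l s0 q12.
(* The terms in pr(a + b) cancel. With s = pr the surplus is 1/2 - 2s - 2s^2, positive for s <=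
   (9/25)^2. *)
have s1 : p * r <= 9 / 25 * (9 / 25) by exact: ler_pM.
have s2 := ler_wpM2l s0 s1.
rewrite -[a * b + a + b]addrA mulrDr sab in sq.
lra.
Qed.
End TwoStars.
End TestVectors.

(** * Connectivity, edge counts, stars and small dominating sets *)

Section Combinatorics.
Variables (T : finType) (G : simple_graph T).

Lemma connected_boundary (S : {set T}) x y : connected_graph G ->
  x \in S -> y \notin S -> exists2 s, s \in S & exists2 t, t \notin S & G s t.
Proof.
move=> cG xS yS.
have [/existsP[s /andP[sS /existsP[t /andP[tS Gst]]]]|] :=
    boolP [exists s, (s \in S) && [exists t, (t \notin S) && G s t]].
  by exists s => //; exists t.
move=> /existsPn nE; have clS : closed G (mem S).
  apply: (intro_closed (sym_connect_sym (adj_sym G))) => a b Gab aS.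
  have := nE a; rewrite aS /= => /existsPn/(_ b); rewrite Gab andbT negbK.
  by [].
have eS := closed_connect clS (cG x y).
by have : y \in S; [rewrite -[_ \in S]eS | rewrite (negPf yS)].
Qed.

(** The double sum counts every edge twice. A vertex set grown from [x0] along boundary edges gains
    at least one edge per new vertex. *)
Lemma connected_edges : connected_graph G ->
  (2 * #|T|.-1 <= \sum_s \sum_t G s t)%N.
Proof.
move=> cG; have [/card0_eq T0|] := posnP #|T|.
  by rewrite eq_card0.
move=> /card_gt0P[x0 _].
suff H k : (k < #|T|)%N -> exists S : {set T},
    [/\ x0 \in S, #|S| = k.+1 & (2 * k <= \sum_(s in S) \sum_(t in S) G s t)%N].
  have Tpos : (0 < #|T|)%N by apply/card_gt0P; exists x0.
  have [|S [_ cS hS]] := H #|T|.-1; first by rewrite prednK.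
  have ST : S = [set: T].
    by apply/eqP; rewrite eqEcard subsetT cardsT cS leqSpred.
  rewrite ST in hS; apply: leq_trans hS _; apply/eq_leq.
  apply: eq_big => [s|s _]; first by rewrite inE.
  by apply: eq_bigl => t; rewrite inE.
elim: k => [_|k IH kT].
  by exists [set x0]; rewrite cards1 inE eqxx.
have [|S [xS cS hS]] := IH; first exact: ltnW.
have [y yS] : exists y, y \notin S.
  apply/existsP; rewrite -negb_forall; apply: contraL kT => /forallP hall.
  by rewrite -leqNgt -cS; apply: subset_leq_card; apply/subsetP => z _.
have [s sS [t tS Gst]] := connected_boundary cG xS yS.
exists (t |: S); rewrite cardsU1 tS cS !inE xS orbT; split=> //.
have rowE z : (\sum_(w in t |: S) G z w = G z t + \sum_(w in S) G z w)%N.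
  by rewrite big_setU1.
rewrite (eq_bigr _ (fun z _ => rowE z)) big_setU1 //= big_split /= mulnS.
rewrite addnA leq_add // -[2%N]/(1 + 1)%N.
apply: leq_add; last by rewrite (bigD1 s) //= Gst leq_addr.
by rewrite adj_irr add0n (bigD1 s) //= adj_sym Gst leq_addr.
Qed.

Lemma star_iso v : dominating_vertex G v ->
    (forall x y, x != v -> y != v -> ~~ G x y) ->
  graph_iso G (complete_bipartite 1 #|T|.-1).
Proof.
move=> dv nE.
have cv : #|T|.-1 = #|[set~ v]| by rewrite cardsC1.
(* The isomorphism is built backwards: this map is injective between sets of equal size. *)
pose g (w : 'I_1 + 'I_#|T|.-1) : T :=
  if w is inr i then enum_val (cast_ord cv i) else v.
have gr i : g (inr i) != v by have := enum_valP (cast_ord cv i); rewrite !inE.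
have ginj : injective g.
  move=> [i|i] [j|j] e.
  - by rewrite (ord1 i) (ord1 j).
  - by have := gr j; rewrite -e eqxx.
  - by have := gr i; rewrite e eqxx.
  - by congr inr; move/enum_val_inj/cast_ord_inj: e.
have Tpos : (0 < #|T|)%N by apply/card_gt0P; exists v.
have [f gK fK] : bijective g.
  by apply: inj_card_bij => //; rewrite card_sum !card_ord add1n prednK.
exists f; first by exists g.
move=> x y; rewrite -{2}(fK x) -{2}(fK y).
case: (f x) (f y) => [i|i] [j|j] /=.
- by rewrite adj_irr.
- by rewrite dv // gr.
- by rewrite adj_sym dv // gr.
- by apply/esym/negbTE/nE; apply: gr.
Qed.

(** The alternatives correspond to a minimum dominating set of size 0, 1 or 2. *)
Lemma domination_number_le2 : (domination_number G <= 2)%N ->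
  [\/ #|T| = 0%N, exists v, dominating_vertex G v |
      exists u v, u != v /\ forall w, w != u -> w != v -> G u w || G v w].
Proof.
rewrite /domination_number; case: arg_minnP => [|D /forallP dD _ D2].
  exact: dominating_setT.
have {}dD w : w \notin D -> exists2 x, x \in D & G x w.
  move=> wD; have := dD w; rewrite wD => /existsP[x /andP[xD Gwx]].
  by exists x => //; rewrite adj_sym.
move: D2; rewrite leq_eqVlt => /orP[/cards2P[u [v [uv DE]]]|]; last first.
  rewrite ltnS leq_eqVlt ltnS leqn0 cards_eq0 => /orP[/cards1P[v DE]|/eqP DE].
    constructor 2; exists v => w wv.
    by have [|x] := dD w; rewrite DE !inE // => /eqP ->.
  constructor 1; apply: eq_card0 => w.
  by have [|x] := dD w; rewrite DE inE.
constructor 3; exists u, v; split=> // w wu wv.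
have [|x] := dD w; first by rewrite DE !inE (negPf wu).
by rewrite DE !inE => /orP[] /eqP -> ->; rewrite ?orbT.
Qed.

End Combinatorics.

(** * Lower bounds by type of domination *)

Section Bounds.
Variables (R : rcfType) (T : finType) (G : simple_graph T).
Hypothesis cG : connected_graph G.

Lemma bipartite_bound (col : pred T) : (forall s t, G s t -> col s != col t) ->
  #|T|%:R - 1 <= s_plus R G.
Proof.
move=> hcol; have [T0|Tpos] := posnP #|T|.
  by rewrite T0; have := s_plus_ge0 R G; lra.
have := connected_edges cG; rewrite -(ler_nat R) -(s_plus_bipartite R hcol).
by rewrite natrM -subn1 natrB //; lra.
Qed.

Lemma dominating_vertex_bound v : dominating_vertex G v ->
  #|T|%:R - 1 <= s_plus R G.
Proof.
move=> dv; have Tpos : (0 < #|T|)%N by apply/card_gt0P; exists v.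
rewrite -(prednK Tpos) -natr1 addrK -(cardsC1 v); apply: (@star_bound _ _ _ v).
  by rewrite !inE eqxx.
by move=> t; rewrite !inE; apply: dv.
Qed.

Lemma dominating_vertex_edge_bound v x y : dominating_vertex G v ->
  x != v -> y != v -> G x y -> #|T|%:R <= s_plus R G.
Proof.
move=> dv xv yv Gxy; have Tpos : (0 < #|T|)%N by apply/card_gt0P; exists v.
rewrite -(prednK Tpos) -natr1 -(cardsC1 v).
apply: (@star_edge_bound _ _ _ v _ x y); rewrite ?inE ?eqxx //.
by move=> t; rewrite !inE; apply: dv.
Qed.

Lemma dominating_pair_bound u v : u != v ->
    (forall w, w != u -> w != v -> G u w || G v w) ->
    ~ dominating_vertex G u -> ~ dominating_vertex G v ->
  #|T|%:R - 1 <= s_plus R G.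
Proof.
move=> uv duv ndu ndv.
pose L := [set t | (t != v) && G u t]; pose M := [set t | (t != u) && G v t].
have uL : u \notin L by rewrite inE adj_irr andbF.
have vL : v \notin L by rewrite inE eqxx.
have uM : u \notin M by rewrite inE eqxx.
have vM : v \notin M by rewrite inE adj_irr andbF.
have GuL : {in L, forall t, G u t} by move=> t; rewrite inE => /andP[].
have GvM : {in M, forall t, G v t} by move=> t; rewrite inE => /andP[].
have cover t : [|| t == u, t == v, t \in L | t \in M].
  rewrite !inE; case: eqP => //= /eqP tu; case: eqP => //= /eqP tv.
  exact: duv.
(* The intersection is added on the left to avoid truncated subtraction. *)
have cardT : (#|T| + #|L :&: M| = #|L| + #|M| + 2)%N.
  rewrite -cardsUI -[LHS]addnC addnAC [LHS]addnC; congr (_ + _)%N.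
  have -> : #|T| = #|u |: (v |: (L :|: M))|.
    rewrite -cardsT; congr #|pred_of_set _|; apply/setP => t.
    by have := cover t; rewrite !inE.
  rewrite !cardsU1 !in_setU1 !in_setU (negPf uv) (negPf uL) (negPf uM).
  by rewrite (negPf vL) (negPf vM) /= !add1n addn2.
have cardTR : #|T|%:R + #|L :&: M|%:R = #|L|%:R + #|M|%:R + 2 :> R.
  by rewrite -!natrD cardT.
have [k2|k1] := ltnP 1 #|L :&: M|.
  by have := two_stars_common_bound R uv uL vL uM vM GuL GvM k2; lra.
have splitL : #|L|%:R = #|L :&: M|%:R + #|L :\: M|%:R :> R.
  by rewrite -natrD cardsID.
have splitM : #|M|%:R = #|L :&: M|%:R + #|M :\: L|%:R :> R.
  by rewrite -natrD setIC cardsID.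
have [/existsP[x /existsP[y /and3P[xL yL Gxy]]]|/existsPn nL] :=
    boolP [exists x, exists y, [&& x \in L, y \in L & G x y]].
  (* Shrinking the second star to [M :\: L] keeps the union, so the leaves still number n - 2. *)
  have dLM : [disjoint L & M :\: L].
    by rewrite -setI_eq0 setIDA setDIl setDv set0I.
  have uM' : u \notin M :\: L by rewrite in_setD negb_and uM orbT.
  have vM' : v \notin M :\: L by rewrite in_setD negb_and vM orbT.
  have GvM' : {in M :\: L, forall t, G v t} by move=> t /setDP[/GvM].
  have := two_stars_edge_bound R uv uL vL uM' vM' GuL GvM' dLM xL yL Gxy; lra.
have [/existsP[x /existsP[y /and3P[xM yM Gxy]]]|/existsPn nM] :=
    boolP [exists x, exists y, [&& x \in M, y \in M & G x y]].
  have dML : [disjoint M & L :\: M].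
    by rewrite -setI_eq0 setIDA setDIl setDv set0I.
  have uL' : u \notin L :\: M by rewrite in_setD negb_and uL orbT.
  have vL' : v \notin L :\: M by rewrite in_setD negb_and vL orbT.
  have GuL' : {in L :\: M, forall t, G u t} by move=> t /setDP[/GuL].
  have vu : v != u by rewrite eq_sym.
  have := two_stars_edge_bound R vu vM uM vL' uL' GvM GuL' dML xM yM Gxy; lra.
have indepL x y : x \in L -> y \in L -> ~~ G x y.
  by move=> xL yL; have := existsPn (nL x) y; rewrite xL yL.
have indepM x y : x \in M -> y \in M -> ~~ G x y.
  by move=> xM yM; have := existsPn (nM x) y; rewrite xM yM.
move: k1; rewrite leq_eqVlt ltnS leqn0 => /orP[/eqP k1|]; last first.
  rewrite cards_eq0 => /eqP LM0.
  (* The colour classes are M with [u] and L with [v]; an edge inside one would yield a common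
     neighbour or an edge inside [L] or [M]. *)
  apply: (bipartite_bound (col := [pred t | (t == u) || (t \in M)])).
  have key s t : G s t -> s \in u |: M -> t \notin u |: M.
    move=> Gst; rewrite !in_setU1 => /orP[/eqP su|sM].
      rewrite negb_or; apply/andP; split.
        by apply: contraTneq Gst => ->; rewrite su adj_irr.
      apply/negP => tM; have : t \in L :&: M; last by rewrite LM0 inE.
      rewrite inE tM andbT inE -su Gst andbT.
      by apply: contraTneq tM => ->.
    rewrite negb_or; apply/andP; split; last first.
      by apply: contraTN Gst => tM; apply: indepM.
    apply: contraTneq Gst => ->; apply/negP => Gsu.
    have : s \in L :&: M; last by rewrite LM0 inE.
    rewrite inE sM andbT inE adj_sym Gsu andbT.
    by apply: contraTneq sM => ->.
  have key2 s t : G s t -> s \notin u |: M -> t \in u |: M.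
    have dec w : w \notin u |: M -> w = v \/ w \in L.
      rewrite in_setU1 negb_or => /andP[wu wM].
      by case/or4P: (cover w) wu wM => [->|/eqP|wL|->] //; [left|right].
    move=> Gst /dec hs; apply: contraTT Gst => /dec ht.
    case: hs => [->|sL]; case: ht => [->|tL].
    - by rewrite adj_irr.
    - apply/negP => Gvt; have : t \in L :&: M; last by rewrite LM0 inE.
      by rewrite inE tL inE Gvt andbT; apply: contraTneq tL => ->.
    - apply/negP => Gsv; have : s \in L :&: M; last by rewrite LM0 inE.
      by rewrite inE sL inE adj_sym Gsv andbT; apply: contraTneq sL => ->.
    - exact: indepL.
  move=> s t Gst; rewrite /= -!in_setU1.
  have := key s t Gst; have := key2 s t Gst.
  by case: (s \in _) => [_ /(_ isT)|/(_ isT) ->] // /negPf ->.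
have [/existsP[x /existsP[y /and3P[xL yM Gxy]]]|/existsPn nX] :=
    boolP [exists x, exists y, [&& x \in L :\: M, y \in M :\: L & G x y]].
  have := two_stars_cross_bound R uv uL vL uM vM GuL GvM k1 xL yM Gxy.
  by move: cardTR; rewrite k1; lra.
have [Guv|nGuv] := boolP (G u v).
  have [c cLM] : exists c, c \in L :&: M by apply/set0Pn; rewrite -card_gt0 k1.
  have [cL cM] : c \in L /\ c \in M by apply/setIP.
  have gt1 (N N' : {set T}) : #|N :&: N'| = 1%N -> (#|N| <= 1)%N -> N \subset N'.
    move=> kN N1; apply/setIidPl/eqP; rewrite eqEcard subsetIl kN; exact: N1.
  (* Otherwise [L] lies in [M] and [v], being adjacent to [u], dominates; [M2] is symmetric. *)
  have L2 : (1 < #|L|)%N.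
    rewrite ltnNge; apply/negP => L1; apply: ndv => w wv.
    have /subsetP LM := gt1 _ _ k1 L1.
    case/or4P: (cover w) wv => [/eqP -> _|->|/LM/GvM|/GvM] //.
    by rewrite adj_sym.
  have M2 : (1 < #|M|)%N.
    rewrite ltnNge; apply/negP => M1; apply: ndu => w wu.
    have /subsetP ML : M \subset L by apply: gt1; rewrite // setIC.
    case/or4P: (cover w) wu => [->|/eqP ->|/GuL|/ML/GuL] //.
  have := two_stars_adjacent_bound R uv uL vL uM vM GuL GvM Guv k1 L2 M2.
  by move: cardTR; rewrite k1; lra.
(* Now [u] and [v] are not adjacent and form one colour class. *)
apply: (bipartite_bound (col := [pred t | (t == u) || (t == v)])).
move=> s t Gst /=.
have out w : w \notin [set u; v] -> (w \in L) || (w \in M).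
  rewrite in_set2 negb_or => /andP[wu wv].
  by have := cover w; rewrite (negPf wu) (negPf wv).
(* An edge from [L] to [M] either has both ends in one of the two sets or joins the two differences;
   all are excluded. *)
have nbr x y : x \in L -> y \in M -> G x y -> False.
  move=> xL yM Gxy.
  have [xM|xM] := boolP (x \in M); first by have := indepM x y xM yM; rewrite Gxy.
  have [yL|yL] := boolP (y \in L); first by have := indepL x y xL yL; rewrite Gxy.
  by have := existsPn (nX x) y; rewrite !in_setD xL xM yL yM Gxy.
rewrite -!in_set2; apply/negP => /eqP e.
have [sS|sS] := boolP (s \in [set u; v]).
  have tS : t \in [set u; v] by rewrite -e.
  move: sS tS Gst nGuv; rewrite !in_set2.
  by move=> /orP[] /eqP -> /orP[] /eqP ->; rewrite ?adj_irr // 1?adj_sym => ->.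
have tS : t \notin [set u; v] by rewrite -e.
have /orP[sL|sM] := out s sS; have /orP[tL|tM] := out t tS.
- by have := indepL s t sL tL; rewrite Gst.
- exact: nbr sL tM Gst.
- by apply: (nbr t s) => //; rewrite adj_sym.
- by have := indepM s t sM tM; rewrite Gst.
Qed.
End Bounds.

Theorem theorem1p5 (R : rcfType) (T : finType) (G : simple_graph T) (n : nat)
    (order_G : #|T| = n) (connected_G : connected_graph G) :
  (~ graph_iso G (complete_bipartite 1 n.-1) ->
   (exists v : T, dominating_vertex G v) ->
   n%:R <= s_plus R G) /\
  ((domination_number G <= 2)%N -> n%:R - 1 <= s_plus R G).
Proof.
rewrite -{n}order_G; split=> [nstar [v dv]|].
  have [/existsP[x /existsP[y /and3P[xv yv Gxy]]]|/existsPn nE] :=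
      boolP [exists x, exists y, [&& x != v, y != v & G x y]].
    exact: dominating_vertex_edge_bound dv xv yv Gxy.
  case: nstar; apply: (star_iso dv) => x y xv yv.
  by have := existsPn (nE x) y; rewrite xv yv.
case/domination_number_le2 => [T0|[v dv]|[u [v [uv duv]]]].
- by rewrite T0; have := s_plus_ge0 R G; lra.
- exact: dominating_vertex_bound dv.
(* Finiteness makes this case split constructive. *)
have decide w : dominating_vertex G w \/ ~ dominating_vertex G w.
  have [/forallP h|/forallP h] := boolP [forall t, (t != w) ==> G w t].
    by left => t; apply/implyP/h.
  by right => dw; apply: h => t; apply/implyP/dw.
have [du|ndu] := decide u; first exact: dominating_vertex_bound du.
have [dv|ndv] := decide v; first exact: dominating_vertex_bound dv.
exact: dominating_pair_bound uv duv ndu ndv.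
Qed.
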